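(* Let $v:[0,+\infty)\to\mathbb{R}$ be locally Lipschitz continuous and let $M>0$. There exists a constant $C\ge 0$ (depending only on $v$ and $M$, hence neither on $N$ nor on time) such that the following holds. For every $N\in\mathbb{N}$, $N\ge1$, and every $X^0=(x_0^0,\ldots,x_N^0)\in\mathbb{R}^{N+1}$ with $x_0^0<\cdots<x_N^0$ and $\overline{R}:=\max_{1\le i\le N}\frac{1}{N(x_i^0-x_{i-1}^0)}\le M$, let $X(t)=(x_0(t),\ldots,x_N(t))$, $t\ge 0$, be the global solution of the Follow-the-Leader system with $X(0)=X^0$ and let $$\rho^N(t,x)=\sum_{i=1}^N R_i(t)\,\mathbf{1}_{[x_{i-1}(t),x_i(t))}(x).$$ Then, for all $s,t\ge 0$, $$\|\rho^N(t,\cdot)-\rho^N(s,\cdot)\|_{L^1(\mathbb{R})}\le C\,TV[\rho^N(0,\cdot)]^{1/2}\,|t-s|^{1/2}.$$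
   Context: For a vector $X(t)=(x_0(t),\ldots,x_N(t))$ with $x_0(t)<\cdots<x_N(t)$ set $R_i(t)=\frac{1}{N(x_i(t)-x_{i-1}(t))}$, $i=1,\ldots,N$. The Follow-the-Leader system, posed on the open set of strictly increasing vectors of $\mathbb{R}^{N+1}$, is $$\dot x_0(t)=\min_{R\in[0,R_1(t)]}v(R),\qquad \dot x_N(t)=\max_{R\in[0,R_N(t)]}v(R),$$ and, for $i\in\{1,\ldots,N-1\}$, $$\dot x_i(t)=\begin{cases}\max_{R\in[R_{i+1}(t),R_i(t)]}v(R)&\text{if }R_i(t)\ge R_{i+1}(t),\\ \min_{R\in[R_i(t),R_{i+1}(t)]}v(R)&\text{if }R_i(t)<R_{i+1}(t).\end{cases}$$ For every strictly increasing initial vector the solution exists, is unique, is global in time and remains strictly increasing. $TV$ denotes total variation on $\mathbb{R}$; explicitly $TV[\rho^N(t,\cdot)]=R_1(t)+\sum_{i=1}^{N-1}|R_{i+1}(t)-R_i(t)|+R_N(t)$. *)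

(* Defs.v *)
From HB Require Import structures.
From mathcomp Require Import all_boot all_order all_algebra.
From mathcomp Require Import all_classical all_reals all_analysis.
Set Implicit Arguments.
Unset Strict Implicit.
Unset Printing Implicit Defensive.
Import Order.TTheory GRing.Theory Num.Theory.
Import numFieldNormedType.Exports.
Local Open Scope classical_set_scope.
Local Open Scope ring_scope.

Definition locally_lipschitz (R : realType) (A : set R) (f : R -> R) : Prop :=
  forall a, A a -> exists2 U, nbhs a U & [lipschitz f x | x in A `&` U].

(* For continuous v and a <= b these are the maximum and the minimum of v on
   [a, b]: see itv_maxP and itv_minP below. *)
Definition itv_max (R : realType) (v : R -> R) (a b : R) : R :=
  sup (v @` `[a, b]).
Definition itv_min (R : realType) (v : R -> R) (a b : R) : R :=
  inf (v @` `[a, b]).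

(* R_i = 1 / (N (x_i - x_{i-1})), meaningful for 1 <= i <= N; in that range
   inord is the inclusion of {0, ..., N} into 'I_N.+1. *)
Definition density (R : realType) (N : nat) (x : 'I_N.+1 -> R) (i : nat) : R :=
  (N%:R * (x (inord i) - x (inord i.-1)))^-1.

Definition increasing_vec (R : realType) (N : nat) (x : 'I_N.+1 -> R) : Prop :=
  forall i j : 'I_N.+1, (i < j)%N -> x i < x j.

Definition FtL_field (R : realType) (v : R -> R) (N : nat)
    (x : 'I_N.+1 -> R) (i : 'I_N.+1) : R :=
  if i == 0%N :> nat then itv_min v 0 (density x 1)
  else if i == N :> nat then itv_max v 0 (density x N)
  else if density x i.+1 <= density x i
       then itv_max v (density x i.+1) (density x i)
       else itv_min v (density x i) (density x i.+1).

(* A classical solution on [0, +oo) staying in the phase space of strictly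
   increasing vectors.  The values X t for t < 0 are irrelevant: at t = 0 only
   right-continuity is required, and the one-sided differential equation there
   follows from the continuity of the field. *)
Definition FtL_solution (R : realType) (v : R -> R) (N : nat)
    (x0 : 'I_N.+1 -> R) (X : R -> 'I_N.+1 -> R) : Prop :=
  [/\ X 0 = x0,
      (forall t, 0 <= t -> increasing_vec (X t)),
      (forall i, {within `[0, +oo[, continuous (fun t : R => X t i)}) &
      (forall (t : R) i, 0 < t ->
         is_derive t (1 : R) (fun s : R => X s i) (FtL_field v (X t) i))].

Definition rho (R : realType) (N : nat) (x : 'I_N.+1 -> R) (y : R) : R :=
  \sum_(1 <= i < N.+1)
    density x i * \1_(`[x (inord i.-1), x (inord i)[) y.

Definition TV_line (R : realType) (f : R -> R) : \bar R :=
  ereal_sup [set total_variation I.1 I.2 f | I in [set I : R * R | I.1 <= I.2]].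

Lemma locally_lipschitz_continuous (R : realType) (A : set R) (f : R -> R) :
  locally_lipschitz A f -> {within A, continuous f}.
Proof.
move=> fl; apply/subspace_continuousP => a Aa.
have [U Ua /pinfty_ex_gt0[k _ /= fk]] := fl a Aa.
have {fk}k_lip y : (A `&` U) y -> `|f a - f y| <= k * `|a - y|.
  move=> AUy; apply: (fk (a, y)); split=> //.
  by split=> //; exact: nbhs_singleton.
apply/cvgrPdist_le => e e0; near=> y.
have AUy : (A `&` U) y.
  by split; near: y; [exact: withinT|exact/cvg_within].
apply: (le_trans (k_lip _ AUy)).
apply: (@le_trans _ _ ((`|k| + 1) * `|a - y|)).
  by apply: ler_wpM2r => //; rewrite (le_trans (ler_norm k))// lerDl.
rewrite mulrC -ler_pdivlMr ?ltr_wpDl//.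
near: y; apply: cvg_within.
have ek : 0 < e / (`|k| + 1) by rewrite divr_gt0// ltr_wpDl.
exact: (cvgr_dist_le (F := nbhs a) id a cvg_id _ ek).
Unshelve. all: by end_near.
Qed.

Lemma itv_maxP (R : realType) (v : R -> R) (a b : R) :
  a <= b -> {within `[a, b], continuous v} ->
  (exists2 r, r \in `[a, b]%R & v r = itv_max v a b) /\
  (forall r, r \in `[a, b]%R -> v r <= itv_max v a b).
Proof.
move=> ab vc; have [c cab cmax] := EVT_max ab vc.
suff <- : v c = itv_max v a b by split=> //; exists c.
have ubc : ubound (v @` `[a, b]) (v c) by move=> _ [r /= rab <-]; exact: cmax.
apply/le_anti/andP; split; last by apply: ge_sup => //; exists (v c), c.
by apply: ub_le_sup; [exists (v c)|exists c].
Qed.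

Lemma itv_minP (R : realType) (v : R -> R) (a b : R) :
  a <= b -> {within `[a, b], continuous v} ->
  (exists2 r, r \in `[a, b]%R & v r = itv_min v a b) /\
  (forall r, r \in `[a, b]%R -> itv_min v a b <= v r).
Proof.
move=> ab vc; have [c cab cmin] := EVT_min ab vc.
suff <- : v c = itv_min v a b by split=> //; exists c.
have lbc : lbound (v @` `[a, b]) (v c) by move=> _ [r /= rab <-]; exact: cmin.
apply/le_anti/andP; split; first by apply: lb_le_inf => //; exists (v c), c.
by apply: ge_inf; [exists (v c)|exists c].
Qed.

(* Main.v *)
Require Import Defs.
From mathcomp Require Import all_boot all_order all_algebra.
From mathcomp Require Import all_classical all_reals all_analysis.
From mathcomp Require Import measurable_realfun ring lra.
Import Order.TTheory GRing.Theory Num.Theory.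
Import numFieldNormedType.Exports.
Local Open Scope classical_set_scope.
Local Open Scope ring_scope.

(** The square root in the time modulus comes from interpolating two bounds on
    the L^1 distance of [rho (X t)] and [rho (X s)]: it is at most 2, since both
    densities have mass 1, and it is at most [K * TV * |t - s|] with [K]
    depending only on [v] and [M].  As [min 2 D <= (2 * D) `^ 2^-1], the theorem
    follows with [C = (2 * K) `^ 2^-1] ([le_powR_half]).

    For the Lipschitz bound, put ghost cells of density 0 outside the platoon
    ([cell x 0 = cell x N.+1 = 0]).  Then every vehicle, including the first and
    the last one, moves with the Godunov flux
    [u_i = godunov v (R_i) (R_{i+1})] of its two neighbouring cells
    ([FtL_field_speed]), and [R_i' = - N R_i^2 (u_i - u_{i-1})].  The flux is
    monotone: a density that is locally maximal cannot grow and one that is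
    locally minimal cannot decrease ([cell_rate_le0], [cell_rate_ge0]).  Hence
    [max_i R_i] does not increase ([cell_max_principle]), so that all densities
    stay in [[0, M]], where [v] is Lipschitz and bounded; and the total
    variation does not increase ([tv_cell_nonincreasing]).  Both quantities are
    maxima of finitely many differentiable functions (for the total variation:
    over all choices of signs of the jumps), and both facts are instances of
    [max_family_bound]: such a maximum does not grow if each function of the
    family has a nonpositive derivative at the times at which it realizes the
    maximum.

    Finally, the L^1 distance of two piecewise constant densities is bounded by
    a change of heights plus a transport of jumps ([Lnorm1_sub_steps]).  Since
    each cell carries the mass [1/N], the first term equals
    [sum_i R_i(s) |L_i(t) - L_i(s)|] with [L_i = x_i - x_{i-1}], and the mean
    value theorem applied to [sum_i +/- L_i] bounds it by
    [2 * Lip(v) * M * TV * |t - s|] ([gap_displacement]); the second one is at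
    most [sup |v| * TV * |t - s|] ([node_displacement]). *)

(** * Functions on the half-line and maxima of finite families *)

(** The regularity that a solution of an ordinary differential equation has on
    the half-line: no derivative is asked for at the initial time. *)
Definition evolves {R : realType} (f df : R -> R) : Prop :=
  {within `[0, +oo[, continuous f} /\
  forall t : R, 0 < t -> is_derive t (1 : R) f (df t).

Lemma evolves_cst {R : realType} (c : R) : evolves (fun=> c) (fun=> 0).
Proof.
split; last by move=> t _; exact: is_derive_cst.
by apply: continuous_subspaceT => t; exact: cvg_cst.
Qed.

Lemma evolvesD {R : realType} {f df g dg : R -> R} :
  evolves f df -> evolves g dg ->
  evolves (fun t => f t + g t) (fun t => df t + dg t).
Proof.
move=> [fc fd] [gc gd]; split=> [|t t0]; first exact: within_continuousD.
by apply: is_deriveD; [exact: fd|exact: gd].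
Qed.

Lemma evolvesZ {R : realType} (c : R) {f df : R -> R} :
  evolves f df -> evolves (fun t => c * f t) (fun t => c * df t).
Proof.
move=> [fc fd]; split=> [|t t0]; last exact: (is_deriveZ (f := f) c (fd t t0)).
move: fc => /subspace_continuousP fc; apply/subspace_continuousP => t t0.
by apply: cvgM; [exact: cvg_cst|exact: fc].
Qed.

Lemma evolvesB {R : realType} {f df g dg : R -> R} :
  evolves f df -> evolves g dg ->
  evolves (fun t => f t - g t) (fun t => df t - dg t).
Proof.
move=> [fc fd] [gc gd]; split=> [|t t0]; first exact: within_continuousB.
by apply: is_deriveB; [exact: fd|exact: gd].
Qed.

Lemma evolves_sum {R : realType} n {f df : 'I_n -> R -> R} :
  (forall i, evolves (f i) (df i)) ->
  evolves (fun t => \sum_i f i t) (fun t => \sum_i df i t).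
Proof.
move=> fdf; elim: (index_enum _) => [|i s ih].
  under eq_fun do rewrite big_nil.
  by under [X in evolves _ X]eq_fun do rewrite big_nil; exact: evolves_cst.
under eq_fun do rewrite big_cons.
by under [X in evolves _ X]eq_fun do rewrite big_cons; exact: evolvesD.
Qed.

Lemma evolvesV {R : realType} {f df : R -> R} :
  (forall t, 0 <= t -> f t != 0) -> evolves f df ->
  evolves (fun t => (f t)^-1) (fun t => - (f t) ^- 2 * df t).
Proof.
move=> f0 [fc fd]; split=> [|t t0]; last first.
  by apply: is_deriveV; [exact/f0/ltW|exact: fd].
move: fc => /subspace_continuousP fc; apply/subspace_continuousP => t t0.
apply: cvgV; last exact: fc.
by apply: f0; move: t0; rewrite /= in_itv/= andbT.
Qed.

Lemma evolves_within {R : realType} {f df : R -> R} (s t : R) :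
  0 <= s -> evolves f df -> {within `[s, t], continuous f}.
Proof.
move=> s0 [fc _]; apply: continuous_subspaceW fc => y /=.
by rewrite !in_itv/= andbT => /andP[/(le_trans s0)].
Qed.

Lemma evolves_increment_le {R : realType} {f df : R -> R} (k s t : R) :
  evolves f df -> (forall u, 0 < u -> df u <= k) ->
  0 <= s <= t -> f t - f s <= k * (t - s).
Proof.
move=> fdf dfk /andP[s0]; rewrite le_eqVlt => /predU1P[<-|st].
  by rewrite !subrr mulr0.
have drv u : u \in `]s, t[%R -> is_derive u (1 : R) f (df u).
  by rewrite in_itv/= => /andP[/(le_lt_trans s0) u0 _]; exact: fdf.2.
have [c /[!in_itv]/= /andP[sc _] ->] :=
  MVT st drv (evolves_within s t s0 fdf).
by rewrite ler_wpM2r ?subr_ge0 ?(ltW st)// dfk// (le_lt_trans s0).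
Qed.

(** Only the left difference quotients of [f] at [c] are compared with [k], so
    [c] may be the right end of the interval on which the maximum is taken. *)
Lemma is_derive_left_slope {R : realType} (f : R -> R) (a c d k : R) :
  is_derive c (1 : R) f d -> a < c ->
  (forall t, a <= t <= c -> f t - k * t <= f c - k * c) -> k <= d.
Proof.
move=> [fc <-] ac fmax; apply/ler_addgt0Pr => e e0.
have [/= r r0 rP] := (cvgrPdist_le _ _).1 fc e e0.
(* A point at the left of c that is both in the ball of radius r and after a. *)
pose h := - Num.min (r / 2) (c - a).
have hlt : 0 < Num.min (r / 2) (c - a) by rewrite lt_min divr_gt0//= subr_gt0.
have h0 : h < 0 by rewrite oppr_lt0.
have hr : `|0 - h| < r.
  rewrite sub0r normrN ltr0_norm// opprK.
  by rewrite gt_min ltr_pdivrMr// ltr_pMr// (ltr_nat _ 1 2).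
have hca : - h <= c - a by rewrite opprK ge_min lexx orbT.
have := rP h hr (ltr0_neq0 h0).
rewrite /= [_%:A]mulr1 ler_norml => /andP[+ _].
rewrite -/('D_1 f c) [_ *: _]mulrC; set q := _ / h => hq.
suff : k <= q by lra.
rewrite /q ler_ndivlMr//.
have := fmax (h + c); have -> : a <= h + c <= c by lra.
by move=> /(_ isT); lra.
Qed.

(** If the maximum of the family grew, then for a small slope [eps > 0] the
    largest value of [f k t - eps * t] over all [k] and all [t] in [[0, T]]
    would be reached at some [k1] and some time [c > 0]; there [f k1] realizes
    the maximum of the family although its derivative is at least [eps].
    Maximizing over [k] and [t] together avoids the differentiation of a
    maximum. *)
Lemma max_family_bound {R : realType} {K : finType} (f df : K -> R -> R)
    (B T : R) :
  (forall k, evolves (f k) (df k)) ->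
  (forall k t, 0 < t -> (forall j, f j t <= f k t) -> df k t <= 0) ->
  (forall k, f k 0 <= B) -> 0 <= T -> forall k, f k T <= B.
Proof.
move=> fdf dec f0B T0 k0; apply/ler_addgt0Pr => e e0.
(* T + 1 rather than T keeps the quotient meaningful for T = 0. *)
pose eps := e / (T + 1).
have eps0 : 0 < eps by rewrite divr_gt0// ltr_wpDl.
pose g k t := f k t - eps * t.
have gmax k : {c | 0 <= c <= T & forall t, 0 <= t <= T -> g k t <= g k c}.
  apply/cid2; have [|c cT cmax] := @EVT_max R (g k) 0 T T0; last by exists c.
  apply: (@evolves_within _ _ (fun t => df k t - eps * 1)) => //.
  apply: evolvesB (fdf k) (evolvesZ eps (_ : evolves id (fun=> 1))).
  split; last by move=> t _; exact: is_derive_id.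
  by apply: continuous_subspaceT => t.
pose c k := s2val (gmax k).
pose k1 := [arg max_(k > k0) g k (c k)]%O.
have gk1 j t : 0 <= t <= T -> g j t <= g k1 (c k1).
  move=> tT; rewrite /k1; case: arg_maxP => // k _ /(_ j isT).
  by apply: le_trans; rewrite /c; case: (gmax j) => u /= _; exact.
have /andP[c0 cT] : 0 <= c k1 <= T by rewrite /c; case: (gmax k1).
have [c_gt0|] := ltP 0 (c k1); last first.
  move=> c_le0; have {c_le0}c0 : c k1 = 0 by apply/le_anti/andP.
  have := gk1 k0 T; rewrite T0 lexx => /(_ isT); rewrite /g c0 mulr0 subr0.
  have := f0B k1; have : eps * T <= e.
    rewrite /eps mulrAC ler_pdivrMr ?ltr_wpDl//.
    by rewrite ler_pM2l// lerDl.
  lra.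
have kmax j : f j (c k1) <= f k1 (c k1).
  by have := gk1 j (c k1); rewrite c0 cT /g => /(_ isT); lra.
have := dec k1 (c k1) c_gt0 kmax.
have : eps <= df k1 (c k1).
  apply: (is_derive_left_slope (f k1) 0 (c k1)) => //; first exact: (fdf k1).2.
  by move=> t /andP[t0 tc]; apply: gk1; rewrite t0 (le_trans tc).
lra.
Qed.

(** * Lipschitz bounds on segments *)

(** Compactness gives one constant [k] that works for all pairs at distance at
    most [1/k]; for the pairs further apart, the oscillation of [v] on the
    segment is at most [k] times the oscillation times the distance. *)
Lemma locally_lipschitz_segment {R : realType} {v : R -> R} {M : R} :
  locally_lipschitz `[0, +oo[ v -> 0 <= M ->
  exists2 L : R, 0 <= L & forall a b, 0 <= a <= M -> 0 <= b <= M ->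
    `|v a - v b| <= L * `|a - b|.
Proof.
move=> vl M0.
have vc : {within `[0, M], continuous v}.
  apply: continuous_subspaceW (locally_lipschitz_continuous vl) => y /=.
  by rewrite !in_itv/= => /andP[->].
have [c1 _ c1max] := EVT_max M0 vc; have [c2 c2M c2min] := EVT_min M0 vc.
pose P (k x : R) := 0 <= x <= M -> forall y, 0 <= y <= M ->
  k * `|x - y| <= 1 -> `|v x - v y| <= k * `|x - y|.
(* The radius is halved so that the ball also contains the points y close to
   x; the bound 2 / e < k turns the condition k |x - y| <= 1 into closeness. *)
have near_diag (a : R) : `[0, M]%classic a ->
    \forall x \near a & k \near +oo, P k x.
  rewrite /= in_itv/= => /andP[a0 aM].
  have [|U Ua /pinfty_ex_gt0[k0 k00 /= Ulip]] := vl a.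
    by rewrite /= in_itv/= a0.
  have [e /= e0 eU] := (nbhs_ballP _ _).1 Ua.
  exists (ball a (e / 2), [set k | k0 < k /\ 2 / e < k]) => /=.
    split; first by apply: nbhsx_ballx; rewrite divr_gt0.
    near=> k; split; near: k; apply: nbhs_pinfty_gt; exact: num_real.
  move=> [x k] /= [ax [k0k ek]] /andP[x0 xM] y /andP[y0 yM] xy1.
  have xy : `|x - y| < e / 2.
    rewrite -(ltr_pM2l (_ : 0 < 2 / e)) ?divr_gt0//.
    rewrite [ltRHS](_ : _ = 1); last by field; rewrite gt_eqF.
    have := normr_ge0 (x - y); rewrite le_eqVlt => /predU1P[<-|xyn0].
      by rewrite mulr0.
    by apply: lt_le_trans xy1; rewrite ltr_pM2r.
  have lip := Ulip (x, y); apply: le_trans (lip _) _ => /=; last first.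
    by rewrite ler_wpM2r// ltW.
  rewrite /ball/= in ax eU; split; split => /=; rewrite ?in_itv/= ?x0 ?y0//.
    by apply: eU => /=; lra.
  apply: eU => /=; have := ler_distD x a y; lra.
have /pinfty_ex_gt0[k k0 /= kP] : \forall k \near +oo, `[0, M] `<=` P k.
  have [covering _] := compact_near_coveringP `[0, M]%classic.
  exact: covering (@segment_compact _ 0 M) _ _ _ _ near_diag.
have W0 : 0 <= v c1 - v c2 by rewrite subr_ge0 c1max.
exists (k + (v c1 - v c2) * k) => [|a b aM bM].
  by rewrite addr_ge0 ?mulr_ge0// ltW.
rewrite mulrDl; have [ab|ab] := leP (k * `|a - b|) 1.
  apply: le_trans (kP a _ aM b bM ab) _; first by rewrite /= in_itv.
  by rewrite lerDl !mulr_ge0// ltW.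
apply: (@le_trans _ _ (v c1 - v c2)); last first.
  by rewrite -mulrA ler_wpDl ?mulr_ge0 ?(ltW k0)// ler_peMr// ltW.
have ia : a \in `[0, M]%R by rewrite in_itv.
have ib : b \in `[0, M]%R by rewrite in_itv.
have := c1max a ia; have := c1max b ib; have := c2min a ia; have := c2min b ib.
rewrite ler_norml; lra.
Unshelve. all: by end_near. Qed.

(** * The Godunov flux *)

(** The right-hand sides of the Follow-the-Leader system in a single formula:
    the Godunov numerical flux of [v] with left state [a] and right state
    [b]. *)
Definition godunov {R : realType} (v : R -> R) (a b : R) : R :=
  if b <= a then itv_max v b a else itv_min v a b.

Section Godunov.
Context {R : realType} {v : R -> R}.
Hypothesis vc : {within `[0, +oo[, continuous v}.

Let vc_itv (a b : R) : 0 <= a -> {within `[a, b], continuous v}.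
Proof.
move=> a0; apply: continuous_subspaceW vc => y /=.
by rewrite !in_itv/= andbT => /andP[/(le_trans a0)].
Qed.

Lemma godunov_ge (a b : R) : 0 <= b -> b <= a ->
  v a <= godunov v a b /\ v b <= godunov v a b.
Proof.
move=> b0 ba; rewrite /godunov ba; have [_ vmax] := itv_maxP ba (vc_itv b a b0).
by split; apply: vmax; rewrite in_itv/= lexx ba.
Qed.

Lemma godunov_le (a b : R) : 0 <= a -> a <= b ->
  godunov v a b <= v a /\ godunov v a b <= v b.
Proof.
move=> a0 ab; rewrite /godunov; case: ifPn => [ba|_].
  have <- : a = b by apply/le_anti; rewrite ab.
  have [[r]] := itv_maxP (lexx a) (vc_itv a a a0).
  by rewrite in_itv/= => /le_anti <- ->.
have [_ vmin] := itv_minP ab (vc_itv a b a0).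
by split; apply: vmin; rewrite in_itv/= lexx ab.
Qed.

Lemma godunov_attained (a b : R) : 0 <= a -> 0 <= b ->
  exists2 r, Num.min a b <= r <= Num.max a b & v r = godunov v a b.
Proof.
move=> a0 b0; rewrite /godunov; case: (leP b a) => [ba|/ltW ab].
  by have [[r]] := itv_maxP ba (vc_itv b a b0); exists r.
by have [[r]] := itv_minP ab (vc_itv a b a0); exists r.
Qed.

(** Both fluxes are compared with [v b]; this is the monotonicity of the flux
    in the only form in which the comparison of densities uses it. *)
Lemma godunov_local_max (a b c : R) : 0 <= a -> 0 <= c ->
  a <= b -> c <= b -> godunov v a b <= godunov v b c.
Proof.
move=> a0 c0 ab cb.
exact: le_trans (godunov_le a b a0 ab).2 (godunov_ge b c c0 cb).1.
Qed.

Lemma godunov_local_min (a b c : R) : 0 <= b ->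
  b <= a -> b <= c -> godunov v b c <= godunov v a b.
Proof.
move=> b0 ba bc.
exact: le_trans (godunov_le b c b0 bc).1 (godunov_ge a b b0 ba).2.
Qed.

(** The fluxes are values of [v] at a point between [b] and [c] and at a point
    between [a] and [b], and both points are compared with [b]. *)
Lemma godunov_lipschitz (L M a b c : R) : 0 <= L ->
  (forall x y, 0 <= x <= M -> 0 <= y <= M -> `|v x - v y| <= L * `|x - y|) ->
  0 <= a <= M -> 0 <= b <= M -> 0 <= c <= M ->
  `|godunov v b c - godunov v a b| <= L * (`|c - b| + `|b - a|).
Proof.
move=> L0 vL /andP[a0 aM] /andP[b0 bM] /andP[c0 cM].
have [r rbc <-] := godunov_attained b c b0 c0.
have [q qab <-] := godunov_attained a b a0 b0.
have near_b x y s : 0 <= x <= M -> 0 <= y <= M ->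
    Num.min x y <= s <= Num.max x y ->
    [/\ 0 <= s <= M, `|s - x| <= `|y - x| & `|s - y| <= `|y - x|].
  move=> xM yM; case: (leP x y) => xy sxy; split; try lra;
  rewrite ler_norml;
  do ?[rewrite ger0_norm; last lra|rewrite ler0_norm; last lra];
  by apply/andP; split; lra.
have [|||rM rb _] := near_b b c r => //; rewrite ?b0 ?c0//.
have [|||qM _ qb] := near_b a b q => //; rewrite ?a0 ?b0//.
apply: le_trans (vL _ _ rM qM) _; rewrite ler_wpM2l//.
by rewrite (le_trans (ler_distD b _ _))// lerD// distrC.
Qed.

Lemma godunov_bounded (V M a b : R) : (forall x, 0 <= x <= M -> `|v x| <= V) ->
  0 <= a <= M -> 0 <= b <= M -> `|godunov v a b| <= V.
Proof.
move=> vV /andP[a0 aM] /andP[b0 bM].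
have [r + <-] := godunov_attained a b a0 b0.
case: (leP a b) => _ /andP[r1 r2]; apply: vV; apply/andP; split; lra.
Qed.

End Godunov.

(** * Piecewise constant functions: L1 distance and total variation *)

Definition steps {R : realType} (N : nat) (p r : nat -> R) (y : R) : R :=
  \sum_(i < N) r i.+1 * \1_(`[p i, p i.+1[) y.

(** Used twice: to write a piecewise constant function as a sum of jumps, and to
    move the signs of the jumps onto the densities in the derivative of the
    total variation. *)
Lemma sum_by_parts {R : comPzRingType} (n : nat) (a b : nat -> R) :
  \sum_(i < n) a i.+1 * (b i - b i.+1) =
  \sum_(i < n.+1) (a i.+1 - a i) * b i + a 0%N * b 0%N - a n.+1 * b n.
Proof.
elim: n => [|n ih]; first by rewrite big_ord0 big_ord1; ring.
by rewrite big_ord_recr ih/= [in RHS]big_ord_recr/=; ring.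
Qed.

Lemma indic_itvco {R : realType} (a b y : R) : a <= b ->
  \1_(`[a, b[) y = (a <= y)%R%:R - (b <= y)%R%:R :> R.
Proof.
move=> ab; rewrite indicE mem_setE/= in_itv/= (ltNge y b).
have [ay|ay] /= := leP a y; first by case: (b <= y); rewrite ?subrr ?subr0.
by rewrite (lt_geF (lt_le_trans ay ab)) subrr.
Qed.

Lemma norm_sub_heaviside {R : realType} (a b y : R) :
  `|(a <= y)%R%:R - (b <= y)%R%:R| = \1_(`[Num.min a b, Num.max a b[) y :> R.
Proof.
case: (leP a b) => [ab|/ltW ba].
  by rewrite -indic_itvco// ger0_norm.
by rewrite distrC -indic_itvco// ger0_norm.
Qed.

Lemma measurable_steps {R : realType} (N : nat) (p r : nat -> R) :
  measurable_fun [set: R] (steps N p r).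
Proof.
by apply: measurable_sum => i; exact: measurable_funM.
Qed.

Section L1.
Context {R : realType}.
Implicit Types p r : nat -> R.

Lemma Lnorm1_le_sum_itv (K : finType) (c a b : K -> R) (f : R -> R) :
  measurable_fun [set: R] f ->
  (forall k, 0 <= c k) -> (forall k, a k <= b k) ->
  (forall y, `|f y| <= \sum_k c k * \1_(`[a k, b k[) y) ->
  ('N[lebesgue_measure]_1[(fun y => (f y)%:E)] <=
   (\sum_k c k * (b k - a k))%:E)%E.
Proof.
move=> mf c0 ab fle; rewrite Lnorm1.
have mitv k : measurable_fun [set: R] (EFin \o (\1_(`[a k, b k[) : R -> R)).
  by apply/measurable_EFinP; exact: measurable_indic.
apply: (@le_trans _ _
  (\int[lebesgue_measure]_y (\sum_k (c k)%:E * (\1_(`[a k, b k[) y)%:E))%E).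
  apply: ge0_le_integral => //.
  - by apply: measurableT_comp => //; exact/measurable_EFinP.
  - by apply: emeasurable_sum => k; exact: (measurable_funeM _ (mitv k)).
  - move=> y _; under eq_bigr do rewrite -EFinM.
    by rewrite sumEFin abse_EFin lee_fin.
rewrite ge0_integral_sum//; last 2 first.
- by move=> k; exact: (measurable_funeM _ (mitv k)).
- by move=> k y _; rewrite mule_ge0// lee_fin.
rewrite -sumEFin; apply: lee_sum => k _.
rewrite ge0_integralZl_EFin//; last exact: mitv.
rewrite integral_indic// setIT EFinM.
apply: lee_wpmul2l; first by rewrite lee_fin.
rewrite /= lebesgue_measure_itv/= lte_fin; case: ifPn => // _.
by rewrite lee_fin subr_ge0.
Qed.

Lemma Lnorm1_sub_steps_le_mass N p p' r r' :
  (forall i, (i < N)%N -> p i <= p i.+1) ->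
  (forall i, (i < N)%N -> p' i <= p' i.+1) ->
  (forall i, 0 <= r i) -> (forall i, 0 <= r' i) ->
  ('N[lebesgue_measure]_1[
     (fun y => (steps N p r y - steps N p' r' y)%:E)] <=
   (\sum_(i < N) r i.+1 * (p i.+1 - p i) +
    \sum_(i < N) r' i.+1 * (p' i.+1 - p' i))%:E)%E.
Proof.
move=> p_le p'_le r0 r'0.
pose sel (q q' : nat -> R) (k : 'I_N + 'I_N) :=
  match k with inl i => q i | inr i => q' i end.
have := Lnorm1_le_sum_itv _ (sel (r \o succn) (r' \o succn)) (sel p p')
  (sel (p \o succn) (p' \o succn)) (fun y => steps N p r y - steps N p' r' y).
rewrite big_sumType/=; apply => [|k|k|y].
- by apply: measurable_funB; exact: measurable_steps.
- by case: k => i /=.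
- by case: k => i /=; [exact: p_le|exact: p'_le].
rewrite big_sumType/= (le_trans (ler_normB _ _))// lerD//.
all: by rewrite ger0_norm// sumr_ge0// => i _; rewrite mulr_ge0.
Qed.

Lemma steps_jumps N p r y :
  (forall i, (i < N)%N -> p i <= p i.+1) -> r 0%N = 0 -> r N.+1 = 0 ->
  steps N p r y = \sum_(i < N.+1) (r i.+1 - r i) * (p i <= y)%R%:R.
Proof.
move=> p_le r0 rN; rewrite /steps.
under eq_bigr => i _ do rewrite indic_itvco ?p_le//.
rewrite (sum_by_parts _ r (fun i => (p i <= y)%R%:R)) r0 rN.
by rewrite !mul0r addr0 subr0.
Qed.

(** Change the heights on the first grid, then move each jump of the second
    function from its place in one grid to its place in the other one.  Writing
    the second step with jumps instead of cells makes its cost proportional to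
    the total variation. *)
Lemma Lnorm1_sub_steps N p p' r r' :
  (forall i, (i < N)%N -> p i <= p i.+1) ->
  (forall i, (i < N)%N -> p' i <= p' i.+1) ->
  r' 0%N = 0 -> r' N.+1 = 0 ->
  ('N[lebesgue_measure]_1[
     (fun y => (steps N p r y - steps N p' r' y)%:E)] <=
   (\sum_(i < N) `|r i.+1 - r' i.+1| * (p i.+1 - p i) +
    \sum_(i < N.+1) `|r' i.+1 - r' i| * `|p i - p' i|)%:E)%E.
Proof.
move=> p_le p'_le r'0 r'N.
pose c (k : 'I_N + 'I_N.+1) := match k with
  | inl i => `|r i.+1 - r' i.+1| | inr i => `|r' i.+1 - r' i| end.
pose a (k : 'I_N + 'I_N.+1) := match k with
  | inl i => p i | inr i => Num.min (p i) (p' i) end.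
pose b (k : 'I_N + 'I_N.+1) := match k with
  | inl i => p i.+1 | inr i => Num.max (p i) (p' i) end.
rewrite [X in (_ <= (_ + X)%:E)%E](_ : _ =
    \sum_(i < N.+1) `|r' i.+1 - r' i| *
      (Num.max (p i) (p' i) - Num.min (p i) (p' i))); last first.
  apply: eq_bigr => i _; congr (_ * _).
  case: (leP (p i) (p' i)) => [le_p|/ltW le_p]; last first.
    by rewrite ger0_norm ?subr_ge0.
  by rewrite distrC ger0_norm ?subr_ge0.
have := Lnorm1_le_sum_itv _ c a b (fun y => steps N p r y - steps N p' r' y).
rewrite big_sumType/=; apply => [|k|k|y].
- by apply: measurable_funB; exact: measurable_steps.
- by case: k => i /=.
- by case: k => i /=; [exact: p_le|rewrite ge_min le_max !lexx].
rewrite big_sumType/=.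
have -> : steps N p r y - steps N p' r' y =
    \sum_(i < N) (r i.+1 - r' i.+1) * \1_(`[p i, p i.+1[) y +
    \sum_(i < N.+1) (r' i.+1 - r' i) * ((p i <= y)%R%:R - (p' i <= y)%R%:R).
  under [X in _ = _ + X]eq_bigr do rewrite mulrBr.
  rewrite sumrB -!steps_jumps// /steps.
  under [X in _ = X + _]eq_bigr do rewrite mulrBl.
  by rewrite sumrB; ring.
rewrite (le_trans (ler_normD _ _))// lerD//.
  rewrite (le_trans (ler_norm_sum _ _ _))// ler_sum// => i _.
  by rewrite normrM (ger0_norm (_ : 0 <= \1_(`[p i, p i.+1[) y)).
rewrite (le_trans (ler_norm_sum _ _ _))// ler_sum// => i _.
by rewrite normrM norm_sub_heaviside.
Qed.

Lemma steps_node N p r i :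
  (forall i j, (i < j <= N)%N -> p i < p j) -> r 0%N = 0 -> r N.+1 = 0 ->
  (i <= N)%N -> steps N p r (p i) = r i.+1.
Proof.
move=> p_lt r0 rN iN; rewrite steps_jumps//; last first.
  by move=> j jN; rewrite ltW// p_lt// leqnn.
have -> : r i.+1 = \sum_(j < i.+1) (r j.+1 - r j).
  rewrite -(big_mkord xpredT (fun j => r j.+1 - r j)) telescope_sumr//.
  by rewrite r0 subr0.
rewrite (big_ord_widen N.+1 (fun j => r j.+1 - r j))// [RHS]big_mkcond.
apply: eq_bigr => j _; have jN : (j <= N)%N by rewrite -ltnS.
rewrite ltnS; case: (ltngtP j i) => [ji|ij|->]; last by rewrite lexx mulr1.
  by rewrite ltW ?mulr1// p_lt// ji.
by rewrite lt_geF ?mulr0// p_lt// ij.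
Qed.

(** The partition consists of the nodes, preceded by one point at the left of
    the support; the value at the last node is already the final 0, because the
    cells are closed on the left and open on the right. *)
Lemma TV_line_steps N p r :
  (forall i j, (i < j <= N)%N -> p i < p j) -> r 0%N = 0 -> r N.+1 = 0 ->
  ((\sum_(i < N.+1) `|r i.+1 - r i|)%:E <= TV_line (steps N p r))%E.
Proof.
move=> p_lt r0 rN.
pose a := p 0%N - 1; pose s := [seq p i | i <- iota 0 N.+1].
have szs : size s = N.+1 by rewrite size_map size_iota.
have apN : a <= p N.
  rewrite (@le_trans _ _ (p 0%N)) ?gerBl//.
  by case: (posnP N) => [->//|N0]; rewrite ltW// p_lt// N0 leqnn.
have part : itv_partition a (p N) s.
  split; last by rewrite -nth_last szs (nth_map 0%N) ?size_iota// nth_iota.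
  rewrite /s/= /a gtrBl ltr01/=; apply/(pathP 0) => i.
  rewrite size_map size_iota => iN.
  rewrite (nth_map 0%N) ?size_iota// nth_iota// add1n.
  case: i iN => [|i] iN /=; first by rewrite p_lt.
  rewrite (nth_map 0%N) ?size_iota 1?ltnW// nth_iota 1?ltnW// add1n.
  by rewrite p_lt// leqnn.
apply: (@le_trans _ _ (total_variation a (p N) (steps N p r))); last first.
  by apply: ereal_sup_ubound; exists (a, p N).
apply: ereal_sup_ubound; exists (variation a (p N) (steps N p r) s).
  by exists s.
rewrite /variation szs big_mkord; congr (_%:E); apply: eq_bigr => i _ /=.
have val j : (j < N.+1)%N -> steps N p r (nth (p N) s j) = r j.+1.
  move=> jN; rewrite (nth_map 0%N) ?size_iota// nth_iota// add0n.
  by rewrite steps_node.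
rewrite val//; case: i => -[|i] iN /=; last by rewrite val// ltnW.
rewrite (_ : steps N p r a = r 0%N)// r0 /steps big1// => j _.
rewrite indicE mem_setE/= in_itv/= lt_geF ?mulr0//.
case: j => -[|j] jN /=; first by rewrite gtrBl.
by rewrite (@lt_trans _ _ (p 0%N)) ?gtrBl// p_lt//= ltnW.
Qed.
End L1.

(** * Densities of a configuration *)

Section Configuration.
Context {R : realType} {N : nat}.
Implicit Types x : 'I_N.+1 -> R.

Definition node x (i : nat) : R := x (inord i).

(** The densities extended by a ghost cell of density 0 on either side.  Index
    0 needs no case: [inord 0.-1 = inord 0], so [density x 0] is the inverse
    of 0. *)
Definition cell x (i : nat) : R := if (i <= N)%N then density x i else 0.

Definition tv_cell x : R := \sum_(i < N.+1) `|cell x i.+1 - cell x i|.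

Lemma node_lt x : increasing_vec x ->
  forall i j, (i < j <= N)%N -> node x i < node x j.
Proof.
move=> xlt i j /andP[ij jN]; apply: xlt.
by rewrite !inordK ?ltnS// ltnW// (leq_trans ij).
Qed.

Lemma node_ltS x i : increasing_vec x -> (i < N)%N -> node x i < node x i.+1.
Proof. by move=> xlt iN; rewrite (node_lt x xlt)// leqnn. Qed.

Lemma cell0 x : cell x 0 = 0.
Proof. by rewrite /cell /density subrr mulr0 invr0. Qed.

Lemma cell_last x : cell x N.+1 = 0.
Proof. by rewrite /cell ltnn. Qed.

Lemma cellE x i : (i < N)%N ->
  cell x i.+1 = (N%:R * (node x i.+1 - node x i))^-1.
Proof. by rewrite /cell => ->. Qed.

Lemma cell_ge0 x i : increasing_vec x -> 0 <= cell x i.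
Proof.
move=> xlt; case: i => [|i]; first by rewrite cell0.
have [iN|Ni] := ltnP i N; last by rewrite /cell ltnNge Ni.
by rewrite cellE// invr_ge0 mulr_ge0// subr_ge0 ltW// node_ltS.
Qed.

Lemma cell_le x m : 0 <= m -> (forall j : 'I_N, cell x j.+1 <= m) ->
  forall i, cell x i <= m.
Proof.
move=> m0 xm [|i]; first by rewrite cell0.
have [iN|Ni] := ltnP i N; first exact: (xm (Ordinal iN)).
by rewrite /cell ltnNge Ni.
Qed.

Lemma rho_steps x : rho x = steps N (node x) (cell x).
Proof.
apply/funext => y; rewrite /rho big_add1/= big_mkord; apply: eq_bigr => i _.
by rewrite /cell ltn_ord.
Qed.

Lemma cell_mass x i : (i < N)%N -> increasing_vec x ->
  cell x i.+1 * (node x i.+1 - node x i) = N%:R^-1.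
Proof.
move=> iN xlt; rewrite cellE// invfM mulfVK// subr_eq0 gt_eqF//.
exact: node_ltS.
Qed.

Lemma sum_cell_mass x : (0 < N)%N -> increasing_vec x ->
  \sum_(i < N) cell x i.+1 * (node x i.+1 - node x i) = 1.
Proof.
move=> N0 xlt; under eq_bigr do rewrite cell_mass//.
by rewrite sumr_const card_ord -[_ *+ _]mulr_natl divff// pnatr_eq0 -lt0n.
Qed.

End Configuration.

Lemma mem_cell_itv {R : realType} {N : nat} (x : 'I_N.+1 -> R) (M : R)
    (i : nat) :
  increasing_vec x -> (forall j, cell x j <= M) -> 0 <= cell x i <= M.
Proof. by move=> xlt xM; rewrite cell_ge0// xM. Qed.

(** * Speeds and rates of change *)

Section Speed.
Context {R : realType} {v : R -> R} {N : nat}.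
Hypothesis vc : {within `[0, +oo[, continuous v}.
Implicit Types x : 'I_N.+1 -> R.

Definition speed (v : R -> R) x (i : nat) : R :=
  godunov v (cell x i) (cell x i.+1).

(** The time derivative of [cell] along the flow.  It vanishes on the ghost
    cells through the factor [cell x i ^+ 2], which makes the formula uniform in
    the index. *)
Definition cell_rate (v : R -> R) x (i : nat) : R :=
  - (N%:R * cell x i ^+ 2 * (speed v x i - speed v x i.-1)).

Lemma FtL_field_speed x (i : 'I_N.+1) : (0 < N)%N -> increasing_vec x ->
  FtL_field v x i = speed v x i.
Proof.
move=> N0 xlt; rewrite /FtL_field /speed /godunov.
have [->|/eqP i0] := eqVneq (i : nat) 0%N.
  have c1 : 0 < cell x 1.
    by rewrite cellE// invr_gt0 mulr_gt0 ?ltr0n// subr_gt0 node_ltS.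
  by rewrite cell0 lt_geF// /cell N0.
have [->|iN] := eqVneq (i : nat) N.
  by rewrite cell_last cell_ge0// /cell leqnn.
have lt_iN : (i < N)%N by rewrite ltn_neqAle iN -ltnS ltn_ord.
by rewrite /cell lt_iN (ltnW lt_iN).
Qed.

Lemma cell_rate_le0 x i : increasing_vec x -> cell x i <= cell x i.+1 ->
  cell x i.+2 <= cell x i.+1 -> cell_rate v x i.+1 <= 0.
Proof.
move=> xlt le_l le_r; rewrite /cell_rate oppr_le0; apply: mulr_ge0.
  by rewrite mulr_ge0 ?sqr_ge0.
by rewrite subr_ge0; apply: godunov_local_max => //; exact: cell_ge0.
Qed.

Lemma cell_rate_ge0 x i : increasing_vec x -> cell x i.+1 <= cell x i ->
  cell x i.+1 <= cell x i.+2 -> 0 <= cell_rate v x i.+1.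
Proof.
move=> xlt le_l le_r; rewrite /cell_rate -mulrN opprB; apply: mulr_ge0.
  by rewrite mulr_ge0 ?sqr_ge0.
by rewrite subr_ge0; apply: godunov_local_min => //; exact: cell_ge0.
Qed.

(** After summation by parts the density of a cell enters with the difference of
    the signs of its two jumps, which is nonzero only for a local maximum or a
    local minimum, and there the sign of the rate lets the total variation only
    decrease.  For a vanishing jump both signs are admissible. *)
Lemma signed_variation_rate_le0 x (sg : nat -> bool) : increasing_vec x ->
  (forall i, (i <= N)%N ->
     (-1) ^+ sg i * (cell x i.+1 - cell x i) = `|cell x i.+1 - cell x i|) ->
  \sum_(i < N.+1) (-1) ^+ sg i * (cell_rate v x i.+1 - cell_rate v x i) <= 0.
Proof.
move=> xlt sgP.
have rate0 : cell_rate v x 0 = 0.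
  by rewrite /cell_rate cell0 expr0n mulr0 mul0r oppr0.
have rateN : cell_rate v x N.+1 = 0.
  by rewrite /cell_rate cell_last expr0n mulr0 mul0r oppr0.
under eq_bigr do rewrite mulrC.
have := sum_by_parts N (cell_rate v x) (fun i => (-1) ^+ sg i : R).
rewrite rate0 rateN !mul0r addr0 subr0 => <-; apply: sumr_le0 => i _.
have jump j : (j <= N)%N ->
    if sg j then cell x j.+1 <= cell x j else cell x j <= cell x j.+1.
  move=> /sgP; have := normr_ge0 (cell x j.+1 - cell x j).
  by case: (sg j); rewrite ?expr1 ?expr0; lra.
have := jump i (ltnW (ltn_ord i)); have := jump i.+1 (ltn_ord i).
case: (sg i); case: (sg i.+1); rewrite ?expr1 ?expr0 ?subrr ?mulr0//.
- by move=> h1 h2; have := cell_rate_ge0 x i xlt h2 h1; lra.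
- by move=> h1 h2; have := cell_rate_le0 x i xlt h2 h1; lra.
Qed.

Lemma sum_speed_jumps_le x (L M : R) : 0 <= L ->
  (forall y z, 0 <= y <= M -> 0 <= z <= M -> `|v y - v z| <= L * `|y - z|) ->
  increasing_vec x -> (forall j, cell x j <= M) ->
  \sum_(i < N) `|speed v x i.+1 - speed v x i| <= 2 * L * tv_cell x.
Proof.
move=> L0 vL xlt xM.
apply: (@le_trans _ _ (\sum_(i < N)
    L * (`|cell x i.+2 - cell x i.+1| + `|cell x i.+1 - cell x i|))).
  apply: ler_sum => i _.
  by apply: (godunov_lipschitz vc L M) => //; exact: mem_cell_itv.
rewrite -mulr_sumr big_split/= [2 * L]mulrC -mulrA ler_wpM2l//.
rewrite mulr2n mulrDl mul1r lerD//.
  by rewrite /tv_cell big_ord_recl/= lerDr.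
by rewrite /tv_cell big_ord_recr/= lerDl.
Qed.

End Speed.

(** * Estimates along the flow *)

Section Flow.
Context {R : realType} {v : R -> R} {N : nat}.
Variables (x0 : 'I_N.+1 -> R) (X : R -> 'I_N.+1 -> R).
Hypothesis vc : {within `[0, +oo[, continuous v}.
Hypothesis N0 : (0 < N)%N.
Hypothesis sol : FtL_solution v x0 X.

Let Xlt (t : R) : 0 <= t -> increasing_vec (X t).
Proof. by case: sol => _ + _ _; exact. Qed.

Lemma evolves_node i : (i <= N)%N ->
  evolves (fun t => node (X t) i) (fun t => speed v (X t) i).
Proof.
case: sol => _ _ Xc Xd iN; split=> [|t t0]; first exact: Xc.
have := Xd t (inord i) t0; rewrite FtL_field_speed// ?inordK//.
exact/Xlt/ltW.
Qed.

Lemma evolves_cell i : (i <= N.+1)%N ->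
  evolves (fun t => cell (X t) i) (fun t => cell_rate v (X t) i).
Proof.
have ghost j : (forall t, cell (X t) j = 0) ->
    evolves (fun t => cell (X t) j) (fun t => cell_rate v (X t) j).
  move=> c0; under eq_fun do rewrite c0.
  under [X in evolves _ X]eq_fun do
    rewrite /cell_rate c0 expr0n mulr0 mul0r oppr0.
  exact: evolves_cst.
case: i => [_|i]; first by apply: ghost => t; exact: cell0.
rewrite leq_eqVlt => /predU1P[[->]|iN].
  by apply: ghost => t; exact: cell_last.
rewrite ltnS in iN.
have gap := evolvesZ N%:R
  (evolvesB (evolves_node i.+1 iN) (evolves_node i (ltnW iN))).
have /evolvesV[|c d] := gap.
  move=> t t0; rewrite mulf_neq0 ?pnatr_eq0 -?lt0n//.
  by rewrite subr_eq0 gt_eqF// node_ltS//; exact: Xlt.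
under eq_fun do rewrite cellE//.
split=> // t t0; apply: is_derive_eq (d t t0) _.
by rewrite /cell_rate cellE// -exprVn /=; ring.
Qed.

Lemma cell_max_principle (M : R) : (forall i, cell x0 i <= M) ->
  forall t i, 0 <= t -> cell (X t) i <= M.
Proof.
move=> x0M t i t0; have M0 : 0 <= M by rewrite -(cell0 x0) x0M.
apply: cell_le => // k.
apply: (max_family_bound (fun (k : 'I_N) t => cell (X t) k.+1)
  (fun k t => cell_rate v (X t) k.+1)) => // [j|j u u0 jmax|j].
- by apply: evolves_cell; rewrite ltnS ltnW.
- have ulx := Xlt u (ltW u0).
  have le_j := cell_le (X u) _ (cell_ge0 (X u) j.+1 ulx) jmax.
  exact: cell_rate_le0.
- by case: sol => -> _ _ _.
Qed.

(** The total variation is the maximum, over all sign vectors [sg], of the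
    signed sums [f sg] of the jumps, and a sign vector that realizes it gives
    each nonzero jump its own sign. *)
Lemma tv_cell_nonincreasing (t : R) : 0 <= t -> tv_cell (X t) <= tv_cell (X 0).
Proof.
move=> t0.
pose jump u (i : nat) := cell (X u) i.+1 - cell (X u) i.
pose f (sg : {ffun 'I_N.+1 -> bool}) u :=
  \sum_(i < N.+1) (-1) ^+ sg i * jump u i.
have signed (b : bool) (y : R) : (-1) ^+ b * y <= `|y|.
  by rewrite (le_trans (ler_norm _))// normrMsign.
have attained u : f [ffun i : 'I_N.+1 => jump u i < 0] u = tv_cell (X u).
  by apply: eq_bigr => i _; rewrite ffunE -normrEsign.
rewrite -attained.
apply: (max_family_bound f (fun sg u => \sum_(i < N.+1) (-1) ^+ sg i *
  (cell_rate v (X u) i.+1 - cell_rate v (X u) i))) => // [sg|sg u u0 sgmax|sg].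
- apply: evolves_sum => i; apply: evolvesZ; apply: evolvesB.
    exact: evolves_cell.
  by apply: evolves_cell; exact: ltnW.
- have term_ge0 (i : 'I_N.+1) : true ->
      0 <= `|jump u i| - (-1) ^+ sg i * jump u i.
    by rewrite subr_ge0.
  have /(psumr_eq0P term_ge0) sgP :
      \sum_(i < N.+1) (`|jump u i| - (-1) ^+ sg i * jump u i) = 0.
    apply/le_anti; rewrite sumr_ge0// andbT sumrB subr_le0.
    by have := sgmax [ffun i : 'I_N.+1 => jump u i < 0]; rewrite attained.
  have := signed_variation_rate_le0 vc (X u) (fun i => sg (inord i))
    (Xlt u (ltW u0)).
  under eq_bigr do rewrite inord_val; apply => i iN.
  have := sgP (inord i) isT; rewrite /= inordK// => /eqP.
  by rewrite subr_eq0 => /eqP <-.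
- by apply: ler_sum => i _; exact: signed.
Qed.

Section Displacement.
Variables L M V : R.
Hypothesis L0 : 0 <= L.
Hypothesis vL : forall y z, 0 <= y <= M -> 0 <= z <= M ->
  `|v y - v z| <= L * `|y - z|.
Hypothesis vV : forall y, 0 <= y <= M -> `|v y| <= V.
Hypothesis x0M : forall i, cell x0 i <= M.

Let XM (t : R) i : 0 <= t -> 0 <= cell (X t) i <= M.
Proof.
by move=> t0; rewrite cell_ge0 ?(cell_max_principle M)//; exact: Xlt.
Qed.

Lemma node_displacement (s t : R) i : 0 <= s -> 0 <= t -> (i <= N)%N ->
  `|node (X t) i - node (X s) i| <= V * `|t - s|.
Proof.
wlog st : s t / s <= t => [H s0 t0 iN|s0 t0 iN].
  have [st|/ltW ts] := leP s t; first exact: H.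
  by rewrite distrC [X in _ * X]distrC; exact: H.
have speedV u : 0 < u -> `|speed v (X u) i| <= V.
  by move=> /ltW u0; apply: (godunov_bounded vc V M) => //; exact: XM.
rewrite [X in _ * X]ger0_norm ?subr_ge0// ler_norml; apply/andP; split.
  have := evolves_increment_le V s t (evolvesZ (-1) (evolves_node i iN)).
  rewrite s0 st; set lhs := _ - _ => H.
  suff : lhs <= V * (t - s) by rewrite /lhs; lra.
  by apply: H => // u /speedV; rewrite ler_norml => /andP[+ _]; lra.
apply: (evolves_increment_le V s t (evolves_node i iN)); last by rewrite s0.
by move=> u /speedV; rewrite ler_norml => /andP[].
Qed.

(** With the signs of the increments of the gaps between [s] and [t] kept fixed,
    the left-hand side is the increment of one differentiable function, whose
    derivative is at most the sum of the speed jumps. *)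
Lemma gap_displacement (s t : R) : 0 <= s -> 0 <= t ->
  \sum_(i < N) `|(node (X t) i.+1 - node (X t) i) -
                 (node (X s) i.+1 - node (X s) i)| <=
  2 * L * tv_cell (X 0) * `|t - s|.
Proof.
wlog st : s t / s <= t => [H s0 t0|s0 t0].
  have [st|/ltW ts] := leP s t; first exact: H.
  rewrite [X in _ * X]distrC; under eq_bigr do rewrite distrC; exact: H.
pose gap u (i : nat) := node (X u) i.+1 - node (X u) i.
pose sg (i : 'I_N) : R := (-1) ^+ (gap t i - gap s i < 0)%R.
rewrite [X in _ * X]ger0_norm ?subr_ge0//.
have -> : \sum_(i < N) `|gap t i - gap s i| =
    \sum_(i < N) sg i * gap t i - \sum_(i < N) sg i * gap s i.
  rewrite -sumrB; apply: eq_bigr => i _.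
  by rewrite -mulrBr /sg -normrEsign.
apply: (evolves_increment_le (f := fun u => \sum_(i < N) sg i * gap u i)
  (df := fun u => \sum_(i < N) sg i * (speed v (X u) i.+1 - speed v (X u) i))).
- apply: evolves_sum => i; apply: evolvesZ; apply: evolvesB.
    exact: evolves_node.
  by apply: evolves_node; exact: ltnW.
- move=> u u0; have u_ge0 := ltW u0.
  apply: (@le_trans _ _ (\sum_(i < N) `|speed v (X u) i.+1 - speed v (X u) i|)).
    apply: ler_sum => i _; rewrite (le_trans (ler_norm _))//.
    by rewrite /sg normrMsign.
  apply: le_trans (sum_speed_jumps_le vc (X u) L M L0 vL _ _) _.
  + exact: Xlt.
  + by move=> j; case/andP: (XM u j u_ge0).
  + by rewrite ler_wpM2l ?mulr_ge0// tv_cell_nonincreasing.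
- by rewrite s0.
Qed.

Lemma rho_L1_lipschitz (s t : R) : 0 <= s -> 0 <= t ->
  ('N[lebesgue_measure]_1[(fun y => (rho (X t) y - rho (X s) y)%:E)] <=
   ((2 * L * M + V) * tv_cell (X 0) * `|t - s|)%:E)%E.
Proof.
move=> s0 t0.
have M0 : 0 <= M by case/andP: (XM 0 0%N (lexx 0)) => /le_trans; exact.
have V0 : 0 <= V by apply: le_trans (vV 0 _); rewrite ?lexx.
rewrite !rho_steps.
apply: le_trans (Lnorm1_sub_steps _ _ _ _ _ _ _ (cell0 _) (cell_last _)) _.
- by move=> i iN; rewrite ltW// node_ltS//; exact: Xlt.
- by move=> i iN; rewrite ltW// node_ltS//; exact: Xlt.
rewrite lee_fin !mulrDl lerD//.
  apply: (@le_trans _ _ (M * (2 * L * tv_cell (X 0) * `|t - s|))); last first.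
    by rewrite le_eqVlt; apply/orP; left; apply/eqP; ring.
  apply: le_trans (ler_wpM2l M0 (gap_displacement s t s0 t0)).
  rewrite mulr_sumr; apply: ler_sum => i _.
  have iN := ltn_ord i.
  have gap_t : 0 < node (X t) i.+1 - node (X t) i.
    by rewrite subr_gt0 node_ltS//; exact: Xlt.
  have mt := cell_mass (X t) i iN (Xlt t t0).
  have ms := cell_mass (X s) i iN (Xlt s s0).
  (* As R_i L_i = 1/N at both times,
     (R_i(t) - R_i(s)) L_i(t) = R_i(s) (L_i(s) - L_i(t)). *)
  rewrite -{1}(ger0_norm (ltW gap_t)) -normrM mulrBl mt -ms.
  rewrite -mulrBr normrM distrC.
  have /andP[c0 cM] := XM s i.+1 s0.
  by rewrite (ger0_norm c0) ler_wpM2r.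
apply: (@le_trans _ _ (\sum_(i < N.+1)
    `|cell (X s) i.+1 - cell (X s) i| * (V * `|t - s|))).
  by apply: ler_sum => i _; rewrite ler_wpM2l// node_displacement// -ltnS.
rewrite -mulr_suml mulrCA mulrA ler_wpM2r// ler_wpM2l//.
exact: tv_cell_nonincreasing.
Qed.

End Displacement.

Lemma rho_L1_le2 (s t : R) : 0 <= s -> 0 <= t ->
  ('N[lebesgue_measure]_1[(fun y => (rho (X t) y - rho (X s) y)%:E)] <= 2%:E)%E.
Proof.
move=> s0 t0; have ts := Xlt t t0; have ss := Xlt s s0.
rewrite !rho_steps.
apply: le_trans (Lnorm1_sub_steps_le_mass _ _ _ _ _ _ _ _ _) _.
- by move=> i iN; rewrite ltW// node_ltS.
- by move=> i iN; rewrite ltW// node_ltS.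
- by move=> i; exact: cell_ge0.
- by move=> i; exact: cell_ge0.
- by rewrite !sum_cell_mass.
Qed.

End Flow.

(** * The Hoelder estimate in time *)

Lemma le_powR_half {R : realType} (a b : R) : 0 <= a -> a <= 2 -> a <= b ->
  a <= (2 * b) `^ 2^-1.
Proof.
move=> a0 a2 ab; have b0 := le_trans a0 ab.
rewrite powR12_sqrt ?mulr_ge0// -(ger0_norm a0) -sqrtr_sqr ler_wsqrtr//.
by rewrite expr2 ler_pM.
Qed.

Theorem proposition3p1 (R : realType) (v : R -> R) (M : R) :
  locally_lipschitz `[0, +oo[ v -> 0 < M ->
  exists2 C : R, 0 <= C &
    forall (N : nat) (x0 : 'I_N.+1 -> R) (X : R -> 'I_N.+1 -> R),
      (1 <= N)%N ->
      increasing_vec x0 ->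
      \big[Num.max/0]_(1 <= i < N.+1) density x0 i <= M ->
      FtL_solution v x0 X ->
      forall s t : R, 0 <= s -> 0 <= t ->
        ('N[lebesgue_measure]_1[
             (fun y : R => (rho (X t) y - rho (X s) y)%R%:E)] <=
         C%:E * (TV_line (rho (X 0%R)) `^ (2^-1)%R) *
           ((`|t - s| `^ (2^-1))%R)%:E)%E.
Proof.
move=> vl M0; have vc := locally_lipschitz_continuous vl.
have [L L0 vL] := locally_lipschitz_segment vl (ltW M0).
pose V := `|v 0| + L * M.
have V0 : 0 <= V by rewrite addr_ge0// mulr_ge0// ltW.
have vV y : 0 <= y <= M -> `|v y| <= V.
  move=> yM; have := vL y 0 yM; rewrite lexx ltW// => /(_ isT).
  rewrite subr0; move: yM => /andP[y0 yM]; rewrite (ger0_norm y0) => vy.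
  have := ler_normD (v y - v 0) (v 0); rewrite subrK => h.
  by apply: le_trans h _; rewrite addrC lerD// (le_trans vy)// ler_wpM2l.
pose K := 2 * L * M + V.
have K0 : 0 <= K by rewrite addr_ge0// !mulr_ge0// ltW.
exists ((2 * K) `^ 2^-1); first exact: powR_ge0.
move=> N x0 X N0 x0lt x0M sol s t s0 t0.
have [_ Xlt _ _] := sol.
have cellM i : cell x0 i <= M.
  apply: cell_le; first exact: ltW.
  move=> j; rewrite /cell ltn_ord (le_trans _ x0M)//.
  by apply: le_bigmax_seq => //; rewrite mem_index_iota/= ltnS ltn_ord.
set T := tv_cell (X 0).
have T0 : 0 <= T by exact: sumr_ge0.
have lip := rho_L1_lipschitz x0 X vc N0 sol L M V L0 vL vV cellM s t s0 t0.
have mass := rho_L1_le2 x0 X N0 sol s t s0 t0.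
have TV_ge : (T%:E <= TV_line (rho (X 0%R)))%E.
  rewrite rho_steps; apply: TV_line_steps; [|exact: cell0|exact: cell_last].
  by apply: node_lt; exact: Xlt.
apply: (@le_trans _ _
  ((2 * K) `^ 2^-1 * T `^ 2^-1 * `|t - s| `^ 2^-1)%:E).
  rewrite -!powRM ?mulr_ge0// -(mulrA 2) -(mulrA 2).
  move: lip mass; rewrite -/K -/T.
  have := Lnorm_ge0 lebesgue_measure 1
    (fun y => (rho (X t) y - rho (X s) y)%:E).
  case: ('N[_]_1[_])%E => [n||]//; rewrite !lee_fin => n0 n1 n2.
  exact: le_powR_half.
rewrite !EFinM; apply: lee_wpmul2r; first by rewrite lee_fin powR_ge0.
apply: lee_wpmul2l; first by rewrite lee_fin powR_ge0.
rewrite -poweR_EFin; apply: gt0_ler_poweR => //.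
- by rewrite in_itv/= leey lee_fin T0.
- by rewrite in_itv/= leey (le_trans _ TV_ge)// lee_fin.
Qed.
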